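(* Let a finite one-dimensional grid with points $i=1,\dots,m$ be given, and for each grid point $i$ let $R_i>0$ be the correlation radius and $\Delta x_i>0$ the grid spacing. Put $$a_{i,0} = 3.738128 + 5.788982\,\frac{R_i}{\Delta x_i} + 3.382473\left(\frac{R_i}{\Delta x_i}\right)^2 + 1.000000\left(\frac{R_i}{\Delta x_i}\right)^3,$$ $$a_{i,1} = 5.788982\,\frac{R_i}{\Delta x_i} + 6.764946\left(\frac{R_i}{\Delta x_i}\right)^2 + 3.000000\left(\frac{R_i}{\Delta x_i}\right)^3,$$ $$a_{i,2} = -3.382473\left(\frac{R_i}{\Delta x_i}\right)^2 - 3.000000\left(\frac{R_i}{\Delta x_i}\right)^3,\qquad a_{i,3} = 1.000000\left(\frac{R_i}{\Delta x_i}\right)^3,$$ and $$\alpha_{i,1}=\frac{a_{i,1}}{a_{i,0}},\quad \alpha_{i,2}=\frac{a_{i,2}}{a_{i,0}},\quad \alpha_{i,3}=\frac{a_{i,3}}{a_{i,0}},\qquad \beta_i=\sqrt[4]{2\pi\left(\frac{R_i}{\Delta x_i}\right)^2}\,\bigl(1-(\alpha_{i,1}+\alpha_{i,2}+\alpha_{i,3})\bigr).$$ Then, for an input distribution $s^0=(s^0_i)_{i=1}^m$, a normalized third-order recursive filter (with filtering coefficients $\beta_i,\alpha_{i,1},\alpha_{i,2},\alpha_{i,3}$ at the $i$-th grid point) is given by the forward recursion $$p_i=\beta_i s^0_i+\alpha_{i,1}p_{i-1}+\alpha_{i,2}p_{i-2}+\alpha_{i,3}p_{i-3},\qquad i=4,5,\dots,m,$$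 followed by the backward recursion $$s_i=\beta_i p_i+\alpha_{i,1}s_{i+1}+\alpha_{i,2}s_{i+2}+\alpha_{i,3}s_{i+3},\qquad i=m-3,m-4,\dots,1.$$
   Context: A (one-iteration) recursive filter of order $n$ on a one-dimensional grid of $m$ points, with filtering coefficients $\beta_i,\alpha_{i,1},\dots,\alpha_{i,n}$ at grid point $i$, maps an input $s^0$ to an output $s$ in two steps: a forward step $p_i=\beta_i s^0_i+\sum_{j=1}^n\alpha_{i,j}p_{i-j}$ with $i$ increasing, and a backward step $s_i=\beta_i p_i+\sum_{j=1}^n\alpha_{i,j}s_{i+j}$ with $i$ decreasing. For $n=3$ the recursions are started by $p_1=\beta_1s^0_1$, $p_2=\beta_2s^0_2+\alpha_{2,1}p_1$, $p_3=\beta_3s^0_3+\alpha_{3,1}p_2+\alpha_{3,2}p_1$ and $s_m=\beta_mp_m$, $s_{m-1}=\beta_{m-1}p_{m-1}+\alpha_{m-1,1}s_m$, $s_{m-2}=\beta_{m-2}p_{m-2}+\alpha_{m-2,1}s_{m-1}+\alpha_{m-2,2}s_m$. The filter serves as an approximation of convolution with the Gaussian $g(x)=\exp(-x^2/(2\sigma^2))$, where $\sigma=R_i/\Delta x_i$ is the non-dimensional length scale at grid point $i$; the Fourier transform of $g$ is $G(w)=\sqrt{2\pi}\,\sigma e^{-(\sigma w)^2/2}$. Normalized: with the coefficients at grid point $i$, the forward and backward steps have transfer functions $$H_{f}(z^{-1})=\frac{\beta_i}{1-\sum_{j=1}^n\alpha_{i,j}z^{-j}},\qquad H_{b}(z)=\frac{\beta_i}{1-\sum_{j=1}^n\alpha_{i,j}z^{j}}.$$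 The filter is normalized if, for every grid point $i$, the total gain at zero frequency ($z=1$) is well defined and equals that of the Gaussian, i.e. $H_f(1)\,H_b(1)=G(0)=\sqrt{2\pi}\,R_i/\Delta x_i$. *)

(* Defs.v *)
From Stdlib Require Import Reals Lra Lia.
From Coquelicot Require Import Coquelicot.
Open Scope R_scope.

(* Grid functions are maps [nat -> R] of which only the values at the grid
   points 1, ..., m matter; the coefficient alpha_{i,j} is [alpha i j]. *)

Definition on_grid (m i : nat) : Prop := (1 <= i <= m)%nat.

(* The recursions of order n.  Terms p_{i-j} and s_{i+j} whose index lies
   outside the grid are dropped, which is how the recursions are started;
   [sum_n_m u 1 0] is the empty sum. *)
Definition forward_step (n m : nat) (beta : nat -> R) (alpha : nat -> nat -> R)
    (s0 p : nat -> R) : Prop :=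
  forall i, on_grid m i ->
    p i = beta i * s0 i
          + sum_n_m (fun j => alpha i j * p (i - j)%nat) 1 (Nat.min n (i - 1)).

Definition backward_step (n m : nat) (beta : nat -> R) (alpha : nat -> nat -> R)
    (p s : nat -> R) : Prop :=
  forall i, on_grid m i ->
    s i = beta i * p i
          + sum_n_m (fun j => alpha i j * s (i + j)%nat) 1 (Nat.min n (m - i)).

Definition recursive_filter (n m : nat) (beta : nat -> R)
    (alpha : nat -> nat -> R) (s0 p s : nat -> R) : Prop :=
  forward_step n m beta alpha s0 p /\ backward_step n m beta alpha p s.

(* The hypotheses on m only matter for grids with fewer than three points,
   where some of the starting equations refer to no grid point. *)
Definition forward_recursion3 (m : nat) (beta : nat -> R)
    (alpha : nat -> nat -> R) (s0 p : nat -> R) : Prop :=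
  ((1 <= m)%nat -> p 1%nat = beta 1%nat * s0 1%nat) /\
  ((2 <= m)%nat ->
     p 2%nat = beta 2%nat * s0 2%nat + alpha 2%nat 1%nat * p 1%nat) /\
  ((3 <= m)%nat ->
     p 3%nat = beta 3%nat * s0 3%nat + alpha 3%nat 1%nat * p 2%nat
               + alpha 3%nat 2%nat * p 1%nat) /\
  (forall i, (4 <= i <= m)%nat ->
     p i = beta i * s0 i + alpha i 1%nat * p (i - 1)%nat
           + alpha i 2%nat * p (i - 2)%nat + alpha i 3%nat * p (i - 3)%nat).

Definition backward_recursion3 (m : nat) (beta : nat -> R)
    (alpha : nat -> nat -> R) (p s : nat -> R) : Prop :=
  ((1 <= m)%nat -> s m = beta m * p m) /\
  ((2 <= m)%nat ->
     s (m - 1)%nat = beta (m - 1)%nat * p (m - 1)%nat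
                     + alpha (m - 1)%nat 1%nat * s m) /\
  ((3 <= m)%nat ->
     s (m - 2)%nat = beta (m - 2)%nat * p (m - 2)%nat
                     + alpha (m - 2)%nat 1%nat * s (m - 1)%nat
                     + alpha (m - 2)%nat 2%nat * s m) /\
  (forall i, (1 <= i <= m - 3)%nat ->
     s i = beta i * p i + alpha i 1%nat * s (i + 1)%nat
           + alpha i 2%nat * s (i + 2)%nat + alpha i 3%nat * s (i + 3)%nat).

(* Fourier transform of x |-> exp (- x^2 / (2 sigma^2)), normalized as
   G(w) = int exp (- x^2 / (2 sigma^2)) e^{-iwx} dx. *)
Definition gaussian_ft (sigma w : R) : R :=
  sqrt (2 * PI) * sigma * exp (- (sigma * w) ^ 2 / 2).

(* H_f is a function of u = z^{-1} and H_b a function of u = z; both are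
   b / (1 - sum_{j=1}^n a_j u^j), b and a being the coefficients at one
   grid point. *)
Definition transfer_den (n : nat) (a : nat -> R) (u : C) : C :=
  (1 - sum_n_m (fun j => RtoC (a j) * u ^ j) 1 n)%C.

Definition H_f (n : nat) (b : R) (a : nat -> R) (u : C) : C :=
  (RtoC b / transfer_den n a u)%C.

Definition H_b (n : nat) (b : R) (a : nat -> R) (u : C) : C :=
  (RtoC b / transfer_den n a u)%C.

(* Division in C is total, so that the gain is well defined is expressed by
   the (common) denominator of H_f and H_b being nonzero at z = 1. *)
Definition normalized (n m : nat) (beta : nat -> R) (alpha : nat -> nat -> R)
    (sigma : nat -> R) : Prop :=
  forall i, on_grid m i ->
    transfer_den n (alpha i) (RtoC 1) <> RtoC 0 /\
    (H_f n (beta i) (alpha i) (RtoC 1) * H_b n (beta i) (alpha i) (RtoC 1))%C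
    = RtoC (gaussian_ft (sigma i) 0).

Lemma gaussian_ft_0 (sigma : R) : gaussian_ft sigma 0 = sqrt (2 * PI) * sigma.
Proof.
unfold gaussian_ft.
replace (- (sigma * 0) ^ 2 / 2) with 0 by field.
rewrite exp_0; ring.
Qed.

(* The coefficients as functions of the length scale r = R_i / Delta x_i. *)
Definition coef_a (r : R) (j : nat) : R :=
  match j with
  | 0%nat => 3.738128 + 5.788982 * r + 3.382473 * r ^ 2 + 1.000000 * r ^ 3
  | 1%nat => 5.788982 * r + 6.764946 * r ^ 2 + 3.000000 * r ^ 3
  | 2%nat => - 3.382473 * r ^ 2 - 3.000000 * r ^ 3
  | 3%nat => 1.000000 * r ^ 3
  | _ => 0
  end.

Definition coef_alpha (r : R) (j : nat) : R := coef_a r j / coef_a r 0.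

Definition coef_beta (r : R) : R :=
  Rpower (2 * PI * r ^ 2) (1 / 4)
  * (1 - (coef_alpha r 1 + coef_alpha r 2 + coef_alpha r 3)).

(* Main.v *)
(** Each recursion expresses the value at a grid point through values with
    a smaller index (forward) or a smaller distance to m (backward), so
    well-founded recursion yields existence and uniqueness of the output.  For the
    normalization, a_1 + a_2 + a_3 and a_0 differ only in the constant term
    3.738128; hence 1 - (alpha_1 + alpha_2 + alpha_3) = 3.738128 / a_0 is
    nonzero, and in the gain at z = 1 it cancels against the same factor of
    beta, leaving the square of the fourth root of 2 pi sigma^2. *)
Require Import Defs.
From Stdlib Require Import Reals Lra Lia Wf_nat.
From Coquelicot Require Import Coquelicot.
Open Scope R_scope.

(** Iterate [F] from the arbitrary seed [f0]. Since [F i] looks only at points of smaller measure,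
    the value at [i] no longer changes once more than [mu i] iterations have been made. A general
    [mu] lets one lemma serve both sweep directions. *)
Lemma measure_recursion (T : Type) (D : nat -> Prop) (mu : nat -> nat)
    (F : nat -> (nat -> T) -> T) (f0 : nat -> T) :
  (forall i f g, D i ->
     (forall j, D j -> (mu j < mu i)%nat -> f j = g j) -> F i f = F i g) ->
  exists f, (forall i, D i -> f i = F i f) /\
    (forall g, (forall i, D i -> g i = F i g) -> forall i, D i -> g i = f i).
Proof.
intros F_local.
set (it := fix it k := match k with
                       | O => f0
                       | S k' => fun i => F i (it k')
                       end).
assert (it_stable : forall k l i, D i ->
          (mu i < k)%nat -> (mu i < l)%nat -> it k i = it l i).
{ induction k as [|k IH]; intros l i Di Hk Hl; [lia|].
  destruct l as [|l]; [lia|]; simpl.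
  apply F_local; [exact Di|]; intros j Dj Hj; apply IH; auto; lia. }
(* A diagonal choice: at each point, the first iterate to which [it_stable] applies. *)
exists (fun i => it (S (mu i)) i).
assert (fix_eq : forall i, D i ->
          it (S (mu i)) i = F i (fun j => it (S (mu j)) j)).
{ intros i Di; apply F_local; [exact Di|]; intros j Dj Hj.
  apply it_stable; auto; lia. }
split; [exact fix_eq|].
intros g Hg.
induction i as [i IH] using (induction_ltof1 nat mu); intros Di.
rewrite (Hg i Di), (fix_eq i Di).
apply F_local; [exact Di|]; intros j Dj Hj; exact (IH j Hj Dj).
Qed.

Lemma forward_step_solvable (n m : nat) (beta : nat -> R)
    (alpha : nat -> nat -> R) (s0 : nat -> R) :
  exists p, forward_step n m beta alpha s0 p /\
    (forall p', forward_step n m beta alpha s0 p' ->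
       forall i, on_grid m i -> p' i = p i).
Proof.
apply (measure_recursion R (on_grid m) (fun i => i)
  (fun i p => beta i * s0 i
     + sum_n_m (fun j => alpha i j * p (i - j)%nat) 1 (Nat.min n (i - 1))) s0).
unfold on_grid; intros i f g Di Hfg; f_equal.
(* The cutoff [Nat.min n (i - 1)] keeps [i - j] on the grid, and [1 <= j] makes it smaller than
   [i]. *)
apply sum_n_m_ext_loc; intros j Hj; rewrite Hfg; [reflexivity|lia|lia].
Qed.

Lemma backward_step_solvable (n m : nat) (beta : nat -> R)
    (alpha : nat -> nat -> R) (p : nat -> R) :
  exists s, backward_step n m beta alpha p s /\
    (forall s', backward_step n m beta alpha p s' ->
       forall i, on_grid m i -> s' i = s i).
Proof.
apply (measure_recursion R (on_grid m) (fun i => m - i)%nat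
  (fun i s => beta i * p i
     + sum_n_m (fun j => alpha i j * s (i + j)%nat) 1 (Nat.min n (m - i))) p).
unfold on_grid; intros i f g Di Hfg; f_equal.
apply sum_n_m_ext_loc; intros j Hj; rewrite Hfg; [reflexivity|lia|lia].
Qed.

Lemma recursive_filter_solvable (n m : nat) (beta : nat -> R)
    (alpha : nat -> nat -> R) (s0 : nat -> R) :
  exists p s, recursive_filter n m beta alpha s0 p s /\
    (forall p' s', recursive_filter n m beta alpha s0 p' s' ->
       forall i, on_grid m i -> p' i = p i /\ s' i = s i).
Proof.
destruct (forward_step_solvable n m beta alpha s0) as [p [Hp p_unique]].
destruct (backward_step_solvable n m beta alpha p) as [s [Hs s_unique]].
exists p, s; split; [split; assumption|].
intros p' s' [Hp' Hs'] i Di.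
split; [exact (p_unique p' Hp' i Di)|].
apply s_unique; [|exact Di].
(* [s'] is driven by [p'], but [p'] and [p] agree on the grid, so [s'] also solves the backward step
   for [p]. *)
intros k Dk; rewrite (Hs' k Dk), (p_unique p' Hp' k Dk); reflexivity.
Qed.

(** The short sums are expanded over any [AbelianMonoid] because the recursions need them in [R] and
    the transfer functions in [C]. *)
Lemma sum_1_1 (G : AbelianMonoid) (u : nat -> G) : sum_n_m u 1 1 = u 1%nat.
Proof. apply sum_n_n. Qed.

Lemma sum_1_2 (G : AbelianMonoid) (u : nat -> G) :
  sum_n_m u 1 2 = plus (u 1%nat) (u 2%nat).
Proof. rewrite sum_n_Sm, sum_1_1; [reflexivity|lia]. Qed.

Lemma sum_1_3 (G : AbelianMonoid) (u : nat -> G) :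
  sum_n_m u 1 3 = plus (plus (u 1%nat) (u 2%nat)) (u 3%nat).
Proof. rewrite sum_n_Sm, sum_1_2; [reflexivity|lia]. Qed.

(** The cutoff [Nat.min 3 (i - 1)] equals 0, 1, 2 at the first three points, which gives the
    starting equations, and 3 from then on. *)
Lemma forward_step3 (m : nat) (beta : nat -> R) (alpha : nat -> nat -> R)
    (s0 p : nat -> R) :
  forward_step 3 m beta alpha s0 p <-> forward_recursion3 m beta alpha s0 p.
Proof.
unfold forward_step, forward_recursion3, on_grid; split.
- intros H; repeat split.
  + intros Hm; rewrite H by lia; simpl.
    rewrite sum_n_m_zero by lia; unfold zero; simpl; ring.
  + intros Hm; rewrite H by lia; simpl.
    rewrite sum_1_1; reflexivity.
  + intros Hm; rewrite H by lia; simpl.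
    rewrite sum_1_2; unfold plus; simpl; ring.
  + intros i Hi; rewrite H by lia.
    replace (Nat.min 3 (i - 1)) with 3%nat by lia.
    rewrite sum_1_3; unfold plus; simpl; ring.
- intros [H1 [H2 [H3 H4]]] i Hi.
  destruct i as [|[|[|[|i]]]]; [lia| | | |].
  + rewrite H1 by lia; simpl.
    rewrite sum_n_m_zero by lia; unfold zero; simpl; ring.
  + rewrite H2 by lia; simpl.
    rewrite sum_1_1; reflexivity.
  + rewrite H3 by lia; simpl.
    rewrite sum_1_2; unfold plus; simpl; ring.
  + rewrite H4 by lia.
    replace (Nat.min 3 (S (S (S (S i))) - 1)) with 3%nat by lia.
    rewrite sum_1_3; unfold plus; simpl; ring.
Qed.

Lemma backward_step3 (m : nat) (beta : nat -> R) (alpha : nat -> nat -> R)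
    (p s : nat -> R) :
  backward_step 3 m beta alpha p s <-> backward_recursion3 m beta alpha p s.
Proof.
unfold backward_step, backward_recursion3, on_grid; split.
- intros H; repeat split.
  + intros Hm; rewrite H by lia.
    replace (Nat.min 3 (m - m)) with 0%nat by lia.
    rewrite sum_n_m_zero by lia; unfold zero; simpl; ring.
  + intros Hm; rewrite H by lia.
    replace (Nat.min 3 (m - (m - 1))) with 1%nat by lia.
    rewrite sum_1_1.
    replace (m - 1 + 1)%nat with m by lia; reflexivity.
  + intros Hm; rewrite H by lia.
    replace (Nat.min 3 (m - (m - 2))) with 2%nat by lia.
    rewrite sum_1_2; unfold plus; simpl.
    replace (m - 2 + 1)%nat with (m - 1)%nat by lia.
    replace (m - 2 + 2)%nat with m by lia; ring.
  + intros i Hi; rewrite H by lia.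
    replace (Nat.min 3 (m - i)) with 3%nat by lia.
    rewrite sum_1_3; unfold plus; simpl; ring.
- intros [H1 [H2 [H3 H4]]] i Hi.
  (* Here the cutoff depends on the distance to [m]. Subtraction is truncated, so the bounds on [m]
     are carried along to unlock the guarded starting equations; in the last case [1 <= i] forces
     [4 <= m]. *)
  assert (cases : i = m \/ (i = m - 1 /\ 2 <= m)%nat \/
                  (i = m - 2 /\ 3 <= m)%nat \/ (i <= m - 3)%nat) by lia.
  destruct cases as [-> | [[-> Hm] | [[-> Hm] | Him]]].
  + rewrite H1 by lia.
    replace (Nat.min 3 (m - m)) with 0%nat by lia.
    rewrite sum_n_m_zero by lia; unfold zero; simpl; ring.
  + rewrite H2 by lia.
    replace (Nat.min 3 (m - (m - 1))) with 1%nat by lia.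
    rewrite sum_1_1.
    replace (m - 1 + 1)%nat with m by lia; reflexivity.
  + rewrite H3 by lia.
    replace (Nat.min 3 (m - (m - 2))) with 2%nat by lia.
    rewrite sum_1_2; unfold plus; simpl.
    replace (m - 2 + 1)%nat with (m - 1)%nat by lia.
    replace (m - 2 + 2)%nat with m by lia; ring.
  + rewrite H4 by lia.
    replace (Nat.min 3 (m - i)) with 3%nat by lia.
    rewrite sum_1_3; unfold plus; simpl; ring.
Qed.

Lemma recursive_filter3 (m : nat) (beta : nat -> R) (alpha : nat -> nat -> R)
    (s0 p s : nat -> R) :
  recursive_filter 3 m beta alpha s0 p s <->
  (forward_recursion3 m beta alpha s0 p /\ backward_recursion3 m beta alpha p s).
Proof.
unfold recursive_filter; rewrite forward_step3, backward_step3; reflexivity.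
Qed.

Lemma transfer_den3_1 (a : nat -> R) :
  transfer_den 3 a (RtoC 1) = RtoC (1 - (a 1%nat + a 2%nat + a 3%nat)).
Proof.
unfold transfer_den; rewrite sum_1_3; unfold plus; simpl.
rewrite RtoC_minus, !RtoC_plus; ring.
Qed.

Lemma coef_a_0_pos (r : R) : 0 < r -> 0 < coef_a r 0.
Proof.
intros Hr; unfold coef_a.
assert (H2 := pow_lt r 2 Hr); assert (H3 := pow_lt r 3 Hr); lra.
Qed.

Lemma coef_alpha_sum_neq_1 (r : R) : 0 < r ->
  1 - (coef_alpha r 1 + coef_alpha r 2 + coef_alpha r 3) <> 0.
Proof.
intros Hr; assert (a0_pos := coef_a_0_pos r Hr).
(* The powers of [r] cancel: 6.764946 is twice 3.382473, and 1 - 3 + 3 - 1 = 0 in the cubic term. *)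
assert (const_term : coef_a r 0 - (coef_a r 1 + coef_a r 2 + coef_a r 3)
                     = 3.738128) by (unfold coef_a; lra).
replace (1 - _) with (3.738128 / coef_a r 0).
- apply Rgt_not_eq, Rdiv_lt_0_compat; lra.
- rewrite <- const_term; unfold coef_alpha.
  field; apply Rgt_not_eq, a0_pos.
Qed.

Lemma Rpower_quarter_sqr (x : R) : 0 < x ->
  Rpower x (1 / 4) * Rpower x (1 / 4) = sqrt x.
Proof.
intros Hx; rewrite <- Rpower_plus, <- Rpower_sqrt by exact Hx.
f_equal; field.
Qed.

Theorem theorem3p1 :
  forall (m : nat) (radius spacing : nat -> R),
    (forall i, on_grid m i -> 0 < radius i) ->
    (forall i, on_grid m i -> 0 < spacing i) ->
    let sigma := fun i : nat => radius i / spacing i in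
    let alpha := fun i j : nat => coef_alpha (sigma i) j in
    let beta := fun i : nat => coef_beta (sigma i) in
    (* the recursions determine an output for every input *)
    (forall s0 : nat -> R,
       exists p s : nat -> R,
         (forward_recursion3 m beta alpha s0 p /\
          backward_recursion3 m beta alpha p s) /\
         (forall p' s' : nat -> R,
            forward_recursion3 m beta alpha s0 p' ->
            backward_recursion3 m beta alpha p' s' ->
            forall i, on_grid m i -> p' i = p i /\ s' i = s i)) /\
    (* they are the recursive filter of order 3 with these coefficients *)
    (forall s0 p s : nat -> R,
       recursive_filter 3 m beta alpha s0 p s <->
       (forward_recursion3 m beta alpha s0 p /\
        backward_recursion3 m beta alpha p s)) /\
    (* which is normalized *)
    normalized 3 m beta alpha sigma.
Proof.
intros m radius spacing radius_pos spacing_pos sigma alpha beta.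
split; [|split].
- intros s0.
  destruct (recursive_filter_solvable 3 m beta alpha s0) as [p [s [H unique]]].
  exists p, s; split; [apply recursive_filter3, H|].
  intros p' s' Hp' Hs'.
  apply unique, recursive_filter3; split; assumption.
- intros s0 p s; apply recursive_filter3.
- intros i Di.
  assert (sigma_pos : 0 < sigma i) by (apply Rdiv_lt_0_compat; auto).
  assert (den_neq_0 := coef_alpha_sum_neq_1 (sigma i) sigma_pos).
  unfold H_f, H_b; rewrite transfer_den3_1; unfold alpha, beta.
  split; [intros H; apply RtoC_inj in H; contradiction|].
  rewrite <- RtoC_div, <- RtoC_mult by exact den_neq_0; f_equal.
  rewrite gaussian_ft_0; unfold coef_beta.
  assert (two_pi_pos : 0 < 2 * PI) by (assert (H := PI_RGT_0); lra).
  transitivity (sqrt (2 * PI * sigma i ^ 2)).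
  + rewrite <- Rpower_quarter_sqr
      by (apply Rmult_lt_0_compat; [exact two_pi_pos|apply pow_lt, sigma_pos]).
    field; exact den_neq_0.
  (* Positivity of [sigma i] is what turns the root of its square back into [sigma i]. *)
  + rewrite sqrt_mult_alt, sqrt_pow2 by lra; reflexivity.
Qed.
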